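(* Let $S$ be a cryptogroup. If $S$ is f-noetherian, then $S$ is finitely generated (as a semigroup).
   Context: A right congruence on a semigroup $S$ is an equivalence relation $\rho$ on $S$ such that $(a,b)\in\rho$ implies $(as,bs)\in\rho$ for all $s\in S$. The right congruence generated by a set $X\subseteq S\times S$ is the smallest right congruence on $S$ containing $X$; a right congruence is finitely generated if it is generated by some finite set $X$. The index of an equivalence relation is the cardinality of its set of equivalence classes. A semigroup $S$ is f-noetherian if every right congruence of finite index on $S$ is finitely generated. A completely regular semigroup is a semigroup which is a union of groups (subgroups). A cryptogroup is a completely regular semigroup on which Green's relation $\mathcal{H}$ is a (two-sided) congruence; here $a\,\mathcal{H}\,b$ iff $S^1a=S^1b$ and $aS^1=bS^1$, with $S^1$ being $S$ with an identity adjoined if necessary. *)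

(* Defs.v *)
From mathcomp Require Import all_boot.
From mathcomp Require Import boolp classical_sets cardinality.

Set Implicit Arguments.
Unset Strict Implicit.
Unset Printing Implicit Defensive.

Local Open Scope classical_set_scope.
Local Open Scope group_scope.

Section Semigroups.
Variable S : semigroupType.
Implicit Types (a b e s x y : S) (A G : set S) (rho X : set (S * S)).

Definition is_equivalence rho := RelationClasses.Equivalence (fun a b => rho (a, b)).

Definition right_congruence rho :=
  is_equivalence rho /\ forall a b s, rho (a, b) -> rho (a * s, b * s).

Definition congruence rho :=
  is_equivalence rho /\
  forall a b s, rho (a, b) -> rho (a * s, b * s) /\ rho (s * a, s * b).

Definition fg_right_congruence rho :=
  exists2 X, finite_set X & rho = smallest right_congruence X.

Definition eq_classes rho : set (set S) := range (fun x => [set y | rho (x, y)]).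

Definition f_noetherian :=
  forall rho, right_congruence rho -> finite_set (eq_classes rho) ->
    fg_right_congruence rho.

Definition subsemigroup A := forall x y, A x -> A y -> A (x * y).

Definition fg_semigroup :=
  exists2 A, finite_set A & smallest subsemigroup A = [set: S].

Definition subgroup G :=
  subsemigroup G /\
  exists2 e, G e &
    (forall x, G x -> e * x = x /\ x * e = x) /\
    (forall x, G x -> exists2 y, G y & x * y = e /\ y * x = e).

Definition completely_regular := \bigcup_(G in subgroup) G = [set: S].

(* S^1 a = {a} \cup S a whether or not S already has an identity, and dually
   a S^1 = {a} \cup a S. *)
Definition left_ideal1 a := [set a] `|` range (fun s => s * a).
Definition right_ideal1 a := [set a] `|` range (fun s => a * s).

Definition green_H : set (S * S) :=
  [set ab | left_ideal1 ab.1 = left_ideal1 ab.2 /\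
            right_ideal1 ab.1 = right_ideal1 ab.2].

Definition cryptogroup := completely_regular /\ congruence green_H.

End Semigroups.

Arguments f_noetherian : clear implicits.
Arguments fg_semigroup : clear implicits.
Arguments completely_regular : clear implicits.
Arguments green_H : clear implicits.
Arguments cryptogroup : clear implicits.

(* Main.v *)
Require Import Defs.
From HB Require Import structures.
From mathcomp Require Import all_boot.
From mathcomp Require Import boolp classical_sets cardinality.

Set Implicit Arguments.
Unset Strict Implicit.
Unset Printing Implicit Defensive.

Local Open Scope classical_set_scope.
Local Open Scope quotient_scope.
Local Open Scope group_scope.

(** The hypothesis passes to the band [B = S / H], since right congruences pull
    back along surjections. The proof shows that [B] is finite, and then that
    each of the finitely many maximal subgroups of [S] is finitely generated;
    these subgroups cover [S].

    All finiteness comes from one observation, [f_noetherian_generated]: if a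
    right congruence of finite index has been generated by pairs with entries
    in a finite set [U], then every right congruence [t] that identifies these
    pairs identifies everything that the first one does. Two congruences of
    finite index are used most: the one that collapses a right ideal with
    finite complement, which shows that such an ideal is finitely generated
    ([cofinite_right_ideal_fg]), and the one whose classes are a filter and its
    complement ([filter_generated]).

    For the band, first divide further by Green's relation J, which gives a
    semilattice [Y]. In [Y] cofinite ideals are finitely generated and filters
    have least elements, and a Koenig argument shows that [Y] is finite
    ([f_noetherian_semilattice_finite]). Then one descends through [Y]: if only
    finitely many elements of [B] lie strictly above a J-class, which is a
    rectangular band, then it has finitely many R-classes and finitely many
    L-classes ([J_class_finite]), hence is finite.

    For the subgroup at an idempotent [e], take the filter of all elements
    J-above [e]. Generators of its universal congruence act on the L-class of
    [e], and since [S] has only finitely many idempotents, this action is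
    described by finitely many elements of the subgroup; these generate it
    ([local_group_fg]). *)

(** * Right congruences of finite index *)

Section RightCongruences.
Variable S : semigroupType.
Implicit Types (a b c s : S) (r t : S -> S -> Prop) (C D F I U : set S).

Definition right_cong r :=
  RelationClasses.Equivalence r /\ forall a b s, r a b -> r (a * s) (b * s).

Lemma right_cong_pairs r :
  right_cong r -> right_congruence [set p | r p.1 p.2].
Proof. by []. Qed.

(** The set [C] represents all classes but one; [D] stands for one block without
    a known element, such as an ideal that is collapsed. *)
Lemma finite_index r C D : RelationClasses.Equivalence r -> finite_set C ->
    (forall a b, D a -> D b -> r a b) ->
    (forall a, D a \/ exists2 c, C c & r a c) ->
  finite_set (eq_classes [set p | r p.1 p.2]).
Proof.
move=> [_ rsym rtrans] finC rD cover.
have [C' finC' cover'] : exists2 C', finite_set C' &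
    forall a, exists2 c, C' c & r a c.
  have [D0|/set0P[d Dd]] := eqVneq D set0.
    by exists C => // a; case: (cover a) => //; rewrite D0.
  exists (C `|` [set d]); first by rewrite finite_setU.
  move=> a; case: (cover a) => [Da|[c Cc rac]].
    by exists d; [right|exact: rD].
  by exists c => //; left.
apply: sub_finite_set (finite_image (fun c => [set b | r c b]) finC').
move=> _ [a _ <-]; have [c C'c rac] := cover' a; exists c => //.
apply/seteqP; split=> b /= h; last exact: rtrans (rsym _ _ rac) h.
exact: rtrans rac h.
Qed.

(** The form in which finite generation is used: [U] collects both coordinates
    of a finite generating set, so any right congruence that contains [r] on
    [U] contains [r] everywhere. Each finiteness result below comes from a
    suitable choice of such a second congruence. *)
Lemma f_noetherian_generated r C D : f_noetherian S -> right_cong r ->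
    finite_set C -> (forall a b, D a -> D b -> r a b) ->
    (forall a, D a \/ exists2 c, C c & r a c) ->
  exists2 U, finite_set U & forall t, right_cong t ->
    (forall u v, U u -> U v -> r u v -> t u v) -> forall a b, r a b -> t a b.
Proof.
move=> nS cr finC rD cover.
have [X finX rX] := nS _ (right_cong_pairs cr) (finite_index cr.1 finC rD cover).
exists ([set p.1 | p in X] `|` [set p.2 | p in X]).
  by rewrite finite_setU; split; apply: finite_image.
move=> t ct tU a b rab.
have : [set p | r p.1 p.2] (a, b) by [].
rewrite rX; apply: smallest_sub (right_cong_pairs ct) _ (a, b) => -[u v] Xuv /=.
apply: tU; [by left; exists (u, v)|by right; exists (u, v)|].
have : [set p | r p.1 p.2] (u, v) by rewrite rX; apply: sub_gen_smallest.
by [].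
Qed.

Definition right_ideal I := forall a s, I a -> I (a * s).

(** Collapsing a right ideal to a point, as in a Rees quotient. *)
Lemma rees_right_cong I :
  right_ideal I -> right_cong (fun a b => a = b \/ I a /\ I b).
Proof.
move=> idI; split; last first.
  by move=> a b s [->|[Ia Ib]]; [left|right; split; apply: idI].
split=> [a|a b|a b c]; first by left.
  by case=> [->|[]]; [left|right].
by case=> [->|[Ia Ib]] // [<-|[_ Ic]]; right.
Qed.

(** The right ideal generated by the finitely many generators of its Rees
    congruence that lie in [I] absorbs all of [I]. *)
Lemma cofinite_right_ideal_fg I : f_noetherian S -> right_ideal I ->
    finite_set (~` I) ->
  exists2 V, finite_set V & V `<=` I /\
    forall a, I a -> exists2 v, V v & a = v \/ exists s, a = v * s.
Proof.
move=> nS idI finI.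
have [I0|/set0P[a0 Ia0]] := eqVneq I set0.
  by exists set0 => //; split=> // a; rewrite I0.
have cover a : I a \/ exists2 c, (~` I) c & a = c \/ I a /\ I c.
  by have [|nIa] := pselect (I a); [left|right; exists a => //; left].
have [U finU genU] := f_noetherian_generated nS (rees_right_cong idI) finI
  (fun a b Ia Ib => or_intror (conj Ia Ib)) cover.
pose V := [set a0] `|` (U `&` I).
pose J := [set a | exists2 v, V v & a = v \/ exists s, a = v * s].
have idJ : right_ideal J.
  move=> a s [v Vv [->|[x ->]]]; exists v => //; right; first by exists s.
  by exists (x * s); rewrite mulgA.
exists V; first by rewrite finite_setU; split=> //; apply: finite_setIl.
split=> [a [->|[]]//|a Ia].
have Ja0 : J a0 by exists a0; [left|left].
have Jgen u v : U u -> U v -> u = v \/ I u /\ I v -> u = v \/ J u /\ J v.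
  move=> Uu Uv [->|[Iu Iv]]; [by left|right].
  by split; [exists u|exists v]; try exact: or_introl; right.
by have [->|[]] := genU _ (rees_right_cong idJ) Jgen a a0 (or_intror (conj Ia Ia0)).
Qed.

(** The set [F] and its complement are the classes of a right congruence. Since
    [F] is closed under factors, a generating chain between elements of [F]
    stays inside [F]; so the universal right congruence of the semigroup [F] is
    itself finitely generated. *)
Lemma filter_generated F : f_noetherian S ->
    (forall a b, F (a * b) <-> F a /\ F b) ->
  exists2 U, finite_set U & U `<=` F /\
    forall t, RelationClasses.Equivalence t ->
      (forall a b s, F a -> F b -> F s -> t a b -> t (a * s) (b * s)) ->
      (forall u v, U u -> U v -> t u v) -> forall a b, F a -> F b -> t a b.
Proof.
move=> nS FM.
have [F0|/set0P[z Fz]] := eqVneq F set0.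
  by exists set0 => //; split=> // t _ _ _ a b; rewrite F0.
have cr : right_cong (fun a b => F a <-> F b).
  split; last by move=> a b s; rewrite !FM => ->.
  by split=> [a|a b|a b c]; tauto.
have cover a : (~` F) a \/ exists2 c, [set z] c & (F a <-> F c).
  by have [|] := pselect (F a); [right; exists z|left].
have rF a b : (~` F) a -> (~` F) b -> (F a <-> F b) by move=> /= ? ?; tauto.
have [U finU genU] := f_noetherian_generated nS cr (finite_set1 z) rF cover.
exists (U `&` F); first exact: finite_setIl.
split=> [a []//|t [trefl tsym ttrans] tM tU a b Fa Fb].
have ct : right_cong (fun a b => (F a <-> F b) /\ (F a -> t a b)).
  split.
    split=> [x|x y [xy h]|x y w [xy h] [yw h']]; split=> //; first by rewrite xy.
    - by move=> Fy; apply/tsym/h/xy.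
    - by rewrite xy.
    - by move=> Fx; apply: ttrans (h Fx) (h' _); apply/xy.
  move=> x y s [xy h]; rewrite !FM xy; split=> // -[Fy Fs].
  have Fx : F x by apply/xy.
  exact: tM (h Fx).
apply: (proj2 (genU _ ct _ a b (conj (fun=> Fb) (fun=> Fa)))) Fa.
by move=> u v Uu Uv Fuv; split=> // Fu; apply: tU; split=> //; apply/Fuv.
Qed.

End RightCongruences.

(** * Quotients *)

Lemma f_noetherian_quotient (S Q : semigroupType) (f : S -> Q) :
    {morph f : a b / a * b} -> (forall q, exists a, f a = q) ->
  f_noetherian S -> f_noetherian Q.
Proof.
move=> fM fsurj nS rho [[refl sym trans] rM] finrho.
pose ff (p : S * S) := (f p.1, f p.2).
have pre (sg : set (Q * Q)) : right_congruence sg -> right_congruence (ff @^-1` sg).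
  move=> [[r1 s1 t1] M1]; split; first split.
  - by move=> a; apply: r1.
  - by move=> a b; apply: s1.
  - by move=> a b c; apply: t1.
  - by move=> a b s; rewrite /ff /= !fM; apply: M1.
have crho : right_congruence rho by [].
have [|X finX rX] := nS _ (pre _ crho).
  apply: sub_finite_set (finite_image (fun A => f @^-1` A) finrho).
  by move=> _ [a _ <-]; exists [set q | rho (f a, q)] => //; exists (f a).
exists (ff @` X); first exact: finite_image.
apply/seteqP; split; last first.
  apply: smallest_sub => // _ [p Xp <-].
  have : smallest (@right_congruence S) X p by apply: sub_gen_smallest.
  by rewrite -rX.
move=> [q q'] rqq'; have [a fa] := fsurj q; have [b fb] := fsurj q'.
have : (ff @^-1` rho) (a, b) by rewrite /ff /= fa fb.
rewrite rX => hab sg [csg Xsg]; rewrite -fa -fb.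
by apply: hab (conj (pre _ csg) _) => p Xp; apply: Xsg; exists p.
Qed.

Lemma quotient_semigroup (S : semigroupType) (rho : set (S * S)) :
    congruence rho ->
  exists (Q : semigroupType) (f : S -> Q),
    [/\ {morph f : a b / a * b}, forall q, exists a, f a = q &
        forall a b, f a = f b <-> rho (a, b)].
Proof.
move=> [[refl sym trans] rM].
pose eqv : rel S := fun a b => `[< rho (a, b) >].
have eqv_refl : reflexive eqv by move=> a; apply/asboolP.
have eqv_sym : symmetric eqv by move=> a b; apply/asboolP/asboolP; apply: sym.
have eqv_trans : transitive eqv.
  by move=> b a c /asboolP ab /asboolP bc; apply/asboolP; apply: trans ab bc.
pose e := EquivRel eqv eqv_refl eqv_sym eqv_trans.
pose f : S -> {eq_quot e} := \pi_{eq_quot e}.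
have fP a b : f a = f b <-> rho (a, b).
  by split=> [/eqquotP/asboolP|h]; last apply/eqquotP/asboolP.
have fK q : f (repr q) = q by apply: reprK.
pose mul (p q : {eq_quot e}) := f (repr p * repr q).
have mulE a b : f (a * b) = mul (f a) (f b).
  apply/fP; apply: (trans _ (a * repr (f b))).
    by apply: (proj2 (rM _ _ _ _)); apply/fP; rewrite fK.
  by apply: (proj1 (rM _ _ _ _)); apply/fP; rewrite fK.
have mulA : associative mul.
  move=> p q r; rewrite -(fK p) -(fK q) -(fK r) -!mulE.
  by rewrite mulgA.
pose Q : semigroupType :=
  HB.pack {eq_quot e} (isSemigroup.Build {eq_quot e} mulA).
by exists Q, f; split=> // q; exists (repr q); apply: fK.
Qed.

(** * Semilattices *)

Section Semilattices.
Variable Y : semigroupType.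
Hypothesis mulC : forall x y : Y, x * y = y * x.
Hypothesis mulxx : forall x : Y, x * x = x.
Implicit Types (x y z u v : Y) (A F I : set Y).

Definition up u := [set x | u * x = u].
Definition down u := [set x | x * u = x].

Lemma up_trans x y z : up x y -> up y z -> up x z.
Proof. by rewrite /up /= => xy yz; rewrite -xy -mulgA yz. Qed.

Lemma up_antisym x y : up x y -> up y x -> x = y.
Proof. by rewrite /up /= => xy yx; rewrite -xy mulC. Qed.

Lemma up_mul z x y : up z (x * y) <-> up z x /\ up z y.
Proof.
split=> [zxy|[zx zy]]; last by rewrite /up /= mulgA zx.
split; apply: up_trans zxy _; rewrite /up /=; last by rewrite -mulgA mulxx.
by rewrite mulC mulgA mulxx.
Qed.

(** A product of finitely many elements bounds them from below. *)
Lemma finite_lower_bound F A z : (forall x y, F (x * y) <-> F x /\ F y) ->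
    F z -> finite_set A -> A `<=` F ->
  exists2 m, F m & A `<=` up m.
Proof.
move=> FM Fz /finite_seqP[s ->]; elim: s => [_|a s IHs sF].
  by exists z => // x; rewrite /= inE.
have [|m Fm sm] := IHs; first by move=> x xs; apply: sF; rewrite /= inE xs orbT.
exists (m * a); first by apply/FM; split=> //; apply: sF; rewrite /= mem_head.
move=> x; rewrite /= inE => /orP[/eqP->|/sm]; first by rewrite /up /= -mulgA mulxx.
by rewrite /up /= => mx; rewrite -mulgA [a * x]mulC mulgA mx.
Qed.

Lemma finite_has_maximal A : finite_set A -> A !=set0 ->
  exists2 m, A m & forall x, A x -> up m x -> x = m.
Proof.
move=> /finite_seqP[s ->]; elim: s => [|a s IHs] [w ws] //.
have [s0|/set0P/IHs[m ms mmax]] := eqVneq [set` s] set0.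
  have snil x : x \in s = false.
    by apply/negP => xs; have : [set` s] x by []; rewrite s0.
  by exists a => [|x]; rewrite /= inE ?eqxx // snil orbF => /eqP.
have [ma|nma] := pselect (up m a); last first.
  exists m => [|x]; rewrite /= inE ?ms ?orbT // => /orP[/eqP->//|]; exact: mmax.
exists a => [|x]; rewrite /= inE ?eqxx // => /orP[/eqP//|xs] ax.
have xm := mmax x xs (up_trans ma ax).
by apply: up_antisym ax; rewrite xm.
Qed.

Lemma cofinite_ideal_bounded I : f_noetherian Y -> right_ideal I ->
    finite_set (~` I) ->
  exists2 V, finite_set V & V `<=` I /\ forall x, I x -> exists2 v, V v & up x v.
Proof.
move=> nY idI finI; have [V finV [VI genV]] := cofinite_right_ideal_fg nY idI finI.
exists V => //; split=> // x /genV[v Vv xv]; exists v => //; rewrite /up /=.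
by case: xv => [->//|[s ->]]; rewrite -mulgA [s * v]mulC mulgA mulxx.
Qed.

(** The universal congruence of a filter is generated by finitely many pairs,
    all of which a common lower bound [m] of their entries identifies. Hence
    translation by [m] is constant on the filter. *)
Lemma filter_has_min F z : f_noetherian Y ->
    (forall x y, F (x * y) <-> F x /\ F y) -> F z ->
  exists2 m, F m & F `<=` up m.
Proof.
move=> nY FM Fz; have [U finU [UF genU]] := filter_generated nY FM.
have [m Fm mU] := finite_lower_bound FM Fz finU UF.
exists m => // x Fx; rewrite /up /= -[RHS]mulxx.
apply: (genU (fun a b => m * a = m * b)) Fx Fm.
- by split=> [a|a b|a b c] // -> ->.
- by move=> a b s _ _ _ h; rewrite !mulgA h.
- by move=> u v /mU -> /mU ->.
Qed.

(** Koenig's argument, on the set [W] of elements [u] with [up u] finite. If [Y]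
    is infinite then so is [W], because a maximal element of its complement
    would belong to it. For [u] in [W] the elements not above [u] form a
    cofinite ideal, so there are finitely many elements strictly below [u] such
    that everything strictly below [u] is below one of them. Hence one can descend forever through elements of [W] with
    infinitely many elements of [W] below them. Such a descent generates a
    filter without a least element. *)
Lemma f_noetherian_semilattice_finite :
  f_noetherian Y -> finite_set [set: Y].
Proof.
move=> nY; apply: contrapT => infY.
pose W := [set u | finite_set (up u)].
have Wup x y : W x -> up x y -> W y.
  by move=> Wx xy; apply: sub_finite_set Wx => z; apply: up_trans.
have W_infinite : ~ finite_set W.
  move=> finW.
  have idW : right_ideal (~` W).
    by move=> a s nWa /Wup Was; apply/nWa/Was/(proj1 (proj1 (up_mul _ _ _) (mulxx _))).
  have [|V finV [VnW leV]] := cofinite_ideal_bounded nY idW; first by rewrite setCK.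
  have [nW0|/set0P[w nWw]] := eqVneq (~` W) set0.
    by apply: infY; rewrite -(setvU W) nW0 set0U.
  have [|m Vm mmax] := finite_has_maximal finV; first by have [v] := leV w nWw; exists v.
  apply: (VnW m Vm); apply: (@sub_finite_set _ _ (W `|` [set m])).
    move=> x mx; have [|nWx] := pselect (W x); first by left.
    have [v Vv xv] := leV x nWx; right.
    have vm := mmax v Vv (up_trans mx xv).
    by apply: up_antisym mx; rewrite -[X in up _ X]vm.
  by rewrite finite_setU.
(* [good]: the nodes of the tree with infinitely many descendants. *)
pose good u := W u /\ ~ finite_set (W `&` down u).
have good_of (V A : set Y) (f : Y -> Y) :
    finite_set V -> ~ finite_set (W `&` A) ->
    (forall x, A x -> exists2 v, V v & up x (f v)) -> exists2 v, V v & good (f v).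
  move=> finV infA cov; apply: contrapT => nogood; apply: infA.
  apply: (@sub_finite_set _ _ (\bigcup_(v in V) (W `&` down (f v)))).
    by move=> x [Wx /cov[v Vv xv]]; exists v.
  apply: bigcup_finite => // v Vv; apply: contrapT => inf; apply: nogood.
  exists v => //; split=> //.
  by have /infinite_setN0[x [Wx xv]] := inf; apply: Wup xv.
have [u0 good0] : exists u, good u.
  have [||V finV [_ leV]] := @cofinite_ideal_bounded setT nY.
  - by [].
  - by rewrite setCT.
  have [|x _|v _ gv] := good_of V setT id finV; last by exists v.
    by rewrite setIT.
  exact: leV.
have good_below u : good u -> exists v, good v /\ up v u /\ v != u.
  move=> [Wu infu].
  have idu : right_ideal (~` up u).
    by move=> a s nua uas; apply: nua; have /up_mul[] := uas.
  have [|V finV [Vnu leV]] := cofinite_ideal_bounded nY idu; first by rewrite setCK.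
  have [||v Vv guv] := good_of V (down u `\ u) (fun v => u * v) finV.
  - move=> h; apply: infu; apply: (@sub_finite_set _ _ ((W `&` (down u `\ u)) `|` [set u])).
      by move=> x [Wx xu]; have [->|/eqP xneu] := eqVneq x u; [right|left].
    by rewrite finite_setU.
  - move=> x [xu xneu].
    have /leV[v Vv xv] : (~` up u) x by move=> ux; apply/xneu/up_antisym.
    by exists v => //; apply/up_mul.
  exists (u * v); split=> //; split.
    by rewrite /up /= mulC mulgA mulxx.
  by apply/eqP => uv; apply: (Vnu v Vv).
have next (p : {u | good u}) :
    {q : {u | good u} | up (sval q) (sval p) /\ sval q != sval p}.
  apply: cid; have [v [gv vp]] := good_below _ (svalP p).
  by exists (exist _ v gv).
have [c [_ cS]] := dependent_choice next (exist _ u0 good0).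
have cdec m n : (m <= n)%N -> up (sval (c n)) (sval (c m)).
  move=> /subnK <-; elim: (n - m)%N => [|k IHk]; first exact: mulxx.
  exact: up_trans (proj1 (cS _)) IHk.
pose F := [set x | exists n, up (sval (c n)) x].
have FM x y : F (x * y) <-> F x /\ F y.
  split=> [[n /up_mul[nx ny]]|[[n nx] [m my]]]; first by split; exists n.
  exists (maxn n m); apply/up_mul; split.
    by apply: up_trans nx; apply/cdec/leq_maxl.
  by apply: up_trans my; apply/cdec/leq_maxr.
have Fc n : F (sval (c n)) by exists n; apply: mulxx.
have [m [n nm] minm] := filter_has_min nY FM (Fc 0%N).
have /negP[] := proj2 (cS n); apply/eqP/up_antisym; first exact: (proj1 (cS n)).
exact: up_trans nm (minm _ (Fc n.+1)).
Qed.

End Semilattices.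

(** * Completely regular semigroups *)

Section CompletelyRegular.
Variables (S : semigroupType) (inv : S -> S).
Hypothesis mulVK : forall x, x * inv x * x = x.
Hypothesis inv_comm : forall x, x * inv x = inv x * x.
Implicit Types a b c e f p t x y : S.

(** The preorder of Green's relation J. As [x = x * inv x * x], no identity
    has to be adjoined. *)
Definition jle a b := exists x y, a = x * b * y.

Lemma jle_refl a : jle a a.
Proof. by exists (a * inv a), (inv a * a); rewrite mulVK mulgA mulVK. Qed.

Lemma jle_trans a b c : jle a b -> jle b c -> jle a c.
Proof. by move=> [x [y ->]] [z [w ->]]; exists (x * z), (w * y); rewrite !mulgA. Qed.

Lemma jle_mull a b : jle (a * b) a.
Proof. by exists (a * inv a), b; rewrite mulVK. Qed.

Lemma jle_mulr a b : jle (a * b) b.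
Proof. by exists a, (inv b * b); rewrite -!mulgA (mulgA b) mulVK. Qed.

Lemma jle_square x : jle x (x * x).
Proof. by exists (inv x), (inv x * x); rewrite !mulgA -inv_comm !mulVK. Qed.

(** If [c = x * a * y = z * b * w], then [c * c] contains the element
    [b * (w * x) * a], which is J-below its own square, and that square contains
    the factor [a * b]. *)
Lemma jle_meet a b c : jle c a -> jle c b -> jle c (a * b).
Proof.
move=> [x [y cxay]] [z [w czbw]].
have hc : jle c (b * (w * x) * a).
  apply: jle_trans (jle_square c) _; exists z, y.
  by rewrite {1}czbw {1}cxay !mulgA.
apply: jle_trans hc _; apply: jle_trans (jle_square _) _.
by exists (b * (w * x)), (w * x * a); rewrite !mulgA.
Qed.

Lemma jle_mulP c a b : jle c (a * b) <-> jle c a /\ jle c b.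
Proof.
split=> [h|[ca cb]]; last exact: jle_meet.
by split; apply: jle_trans h _; [apply: jle_mull|apply: jle_mulr].
Qed.

(** Write [e = p * q] with [p] in [e S f]. The idempotent [p0 = p * inv p] is a
    left identity of [p], hence of [e]; and [p0 * f = p0], because [p] lies in
    [S f]. With [f] below [e], this forces [p0], [e] and [f] to coincide. *)
Lemma J_idem_eq e f : e * e = e -> f * f = f -> e * f = f -> f * e = f ->
  jle e f -> e = f.
Proof.
move=> ee ff ef fe [x [y exfy]].
pose p := e * x * f; pose q := f * y * e; pose p0 := p * inv p.
have pq : p * q = e.
  by rewrite /p /q -!mulgA (mulgA f f) ff !mulgA -(mulgA e x) -(mulgA e (x * f)) -exfy ee ee.
have pf : p * f = p by rewrite /p -mulgA ff.
have p0p : p0 * p = p by apply: mulVK.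
have p0f : p0 * f = p0 by rewrite /p0 inv_comm -mulgA pf.
have p0e : p0 * e = e by rewrite -pq mulgA p0p.
by rewrite -{1}p0e -p0f -mulgA fe p0f -ef -{1}p0e -mulgA ef p0f.
Qed.

(** An [x] as here belongs to the maximal subgroup at [e]: its idempotent is
    comparable with [e] and in the same J-class. *)
Lemma local_group_inv e x : e * e = e -> e * x = x -> x * e = x -> jle e x ->
  x * inv x = e.
Proof.
move=> ee ex xe le_ex; apply/esym/J_idem_eq => //.
- by rewrite mulgA mulVK.
- by rewrite mulgA ex.
- by rewrite inv_comm -mulgA xe.
- by apply: jle_trans le_ex _; rewrite -{1}(mulVK x); apply: jle_mull.
Qed.

(** Stability: an element of [S e] in the J-class of [e] is L-related to [e]. Its
    idempotent [f] then is L-related to [e] too; indeed [e * f] is an idempotent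
    below [e] and in the same J-class. *)
Lemma L_class_idem e t : e * e = e -> t * e = t -> jle e t ->
  (t * inv t) * e = t * inv t /\ e * (t * inv t) = e.
Proof.
move=> ee te le_et; set f := t * inv t.
have fe : f * e = f by rewrite /f inv_comm -mulgA te.
have ff : f * f = f by rewrite /f mulgA mulVK.
split=> //; apply/esym/J_idem_eq => //.
- by rewrite mulgA -(mulgA e f) fe -mulgA ff.
- by rewrite mulgA ee.
- by rewrite -mulgA fe.
- apply: jle_meet; first exact: jle_refl.
  by apply: jle_trans le_et _; rewrite -{1}(mulVK t); apply: jle_mull.
Qed.

(** Let [U] generate the universal congruence of the filter above [e]. For
    [t] L-related to [e] with idempotent [f], the product [e * u * t] splits
    as [(e * u * f) * (e * t)], both factors in the subgroup at [e]. So for all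
    generating pairs, a quotient of two elements of the form [e * u * f] takes
    [e * v * t] to [e * u * t]. Products of such quotients then do the same for
    all pairs in the filter: asking this for every [t] in the L-class of [e]
    gives a relation compatible with right multiplication, as the filter acts
    on that L-class from the left. The pair [(x, e)] with [x] in the subgroup,
    and [t = e], shows that [x] is a product of these quotients. *)
Lemma local_group_fg e : f_noetherian S ->
    finite_set [set f : S | f * f = f] -> e * e = e ->
  exists2 A, finite_set A & forall x, e * x = x -> x * e = x -> jle e x ->
    smallest (@subsemigroup S) A x.
Proof.
move=> nS finE ee.
have [U finU [Ue genU]] := filter_generated nS (jle_mulP e).
pose A0 := [set e * u * f | u in U & f in [set f : S | f * f = f]].
have finA0 : finite_set A0 by apply: finite_image2.
pose A := [set e] `|` [set x * inv y | x in A0 & y in A0].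
exists A; first by rewrite finite_setU; split=> //; apply: finite_image2.
pose P := smallest (@subsemigroup S) A.
have PM x y : P x -> P y -> P (x * y).
  by move=> Px Py B BA; apply: (BA.1); [apply: Px|apply: Py].
have Pe : P e by apply: sub_gen_smallest; left.
pose moved a b := forall t, t * e = t -> jle e t ->
  exists2 p, P p & e * a * t = p * (e * b * t).
have moved_trans a b c : moved a b -> moved b c -> moved a c.
  move=> ab bc t te et; have [p Pp ->] := ab t te et.
  by have [q Pq ->] := bc t te et; exists (p * q); [apply: PM|rewrite mulgA].
have movedM a b s : jle e s -> moved a b -> moved (a * s) (b * s).
  move=> es ab t te et.
  have [||p Pp h] := ab (s * t); [by rewrite -mulgA te|exact: jle_meet|].
  by exists p; rewrite // -!mulgA in h *.
have movedU u v : U u -> U v -> moved u v.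
  move=> Uu Uv t te et.
  have [f [fe ef ff ft]] : exists f, [/\ f * e = f, e * f = e, f * f = f & f * t = t].
    exists (t * inv t); have [-> ->] := L_class_idem ee te et.
    by rewrite mulgA !mulVK.
  have split_at w : e * w * t = (e * w * f) * (e * t).
    by rewrite -!mulgA (mulgA f e) fe ft.
  have A0f w : U w -> A0 (e * w * f) by exists w => //; exists f.
  have ewf w : e * w * f * e = e * w * f by rewrite -mulgA fe.
  have eewf w : e * (e * w * f) = e * w * f by rewrite !mulgA ee.
  have invK : inv (e * v * f) * (e * v * f) = e.
    rewrite -inv_comm; apply: local_group_inv => //.
    apply: jle_meet; last by rewrite -{1}ef; apply: jle_mulr.
    by apply: jle_meet; [apply: jle_refl|apply: Ue].
  exists (e * u * f * inv (e * v * f)).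
    apply: sub_gen_smallest; right; exists (e * u * f); first exact: A0f.
    by exists (e * v * f) => //; apply: A0f.
  by rewrite !split_at -[RHS]mulgA (mulgA (inv _)) invK (mulgA e e) ee.
move=> x ex xe le_ex.
have [xe_moved _] : moved x e /\ moved e x.
  apply: (genU (fun a b => moved a b /\ moved b a)) le_ex (jle_refl e).
  - split=> [a|a b []//|a b c [ab ba] [bc cb]].
      by split=> t te et; exists e; rewrite // !mulgA ee.
    by split; [apply: moved_trans ab bc|apply: moved_trans cb ba].
  - by move=> a b s _ _ es [ab ba]; split; apply: movedM.
  - by move=> u v Uu Uv; split; apply: movedU.
have [p Pp] := xe_moved e ee (jle_refl e).
by rewrite ex xe ee ee => ->; apply: PM.
Qed.

End CompletelyRegular.

(** * Bands *)

Section Bands.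
Variable B : semigroupType.
Hypothesis mulxx : forall x : B, x * x = x.
Implicit Types a b c k p q s u v x y : B.

(* A band is completely regular, each element being its own inverse. *)
Let mulVK x : x * id x * x = x. Proof. by rewrite !mulxx. Qed.
Let inv_comm x : x * id x = id x * x. Proof. by []. Qed.
Let jrefl := jle_refl mulVK.
Let jmull := jle_mull mulVK.
Let jmulr := jle_mulr mulVK.
Let jmulP := jle_mulP mulVK inv_comm.

(** The idempotent [a * b * a] lies below [a] and in the same J-class. *)
Lemma rectangular a b : jle a b -> a * b * a = a.
Proof.
move=> ab; apply/esym/(J_idem_eq mulVK inv_comm); rewrite ?mulxx //.
- by rewrite !mulgA mulxx.
- by rewrite -mulgA mulxx.
- by apply/jmulP; split=> //; apply/jmulP.
Qed.

(** Green's relation L, in the form it takes for idempotents. *)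
Definition lrel a b := a * b = a /\ b * a = b.

Lemma lrel_refl a : lrel a a. Proof. by rewrite /lrel mulxx. Qed.

Lemma lrel_sym a b : lrel a b -> lrel b a. Proof. by case. Qed.

Lemma lrel_trans a b c : lrel a b -> lrel b c -> lrel a c.
Proof.
move=> [ab ba] [bc cb]; split; first by rewrite -{1}ab -mulgA bc.
by rewrite -{1}cb -mulgA ba.
Qed.

Lemma lrelM a b s : lrel a b -> lrel (a * s) (b * s).
Proof.
have half x y : x * y = x -> (x * s) * (y * s) = x * s.
  by move=> xy; rewrite -{1}xy -(mulgA x y s) -mulgA mulxx mulgA xy.
by move=> [ab ba]; split; apply: half.
Qed.

Lemma lrel_mull a b : jle b a -> lrel (a * b) b.
Proof. by move=> ba; split; rewrite ?mulgA ?rectangular // -mulgA mulxx. Qed.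

(** The R-classes and the L-classes of a J-class [K] are bounded separately.
    The complement of the finite set [T] strictly above [K] is a cofinite
    right ideal, and generators of it that reach [K] must lie in [K], where
    right multiplication preserves R-classes.
    For L-classes, consider the right congruence with classes [K], the
    singletons of [T] and everything else. An element of [K] acts on the right
    on L-classes of [K] as a constant, so translating a generating pair by it
    gives L-related elements. Only translations by the finite set [T] move
    between L-classes, so generating chains meet only finitely many of them
    unless there is just one. *)
Lemma J_class_finite k : f_noetherian B ->
    finite_set [set x | jle k x /\ ~ jle x k] ->
  finite_set [set x | jle k x /\ jle x k].
Proof.
move=> nB; set T := [set x | _ /\ ~ _] => finT; set K := [set x | _ /\ _].
pose F := [set x | jle k x].
have FM x y : F (x * y) <-> F x /\ F y by apply: jmulP.
have KF x : K x -> F x by case.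
have FTK x : F x -> T x \/ K x.
  by move=> kx; have [|] := pselect (jle x k); [right|left].
have KM a s : K a -> F s -> K (a * s).
  by move=> [ka ak] ks; split; [apply/jmulP|apply: jle_trans (jmull _ _) ak].
have [V finV VR] : exists2 V, finite_set V &
    forall x, K x -> exists2 v, V v & jle v k /\ v * x = x.
  have idT : right_ideal (~` T).
    move=> x s nTx [/FM[kx _] nxs]; apply: nTx; split=> // xk.
    by apply/nxs/(jle_trans _ xk)/jmull.
  have [|V finV [VT genV]] := cofinite_right_ideal_fg nB idT; first by rewrite setCK.
  exists V => // x Kx; have nTx : (~` T) x by case: Kx => ? ? [].
  have [v Vv xv] := genV x nTx; exists v => //.
  have vx : v * x = x by case: xv => [->|[s ->]]; rewrite ?mulgA mulxx.
  split=> //; apply: contrapT => nvk; apply: (VT v Vv); split=> //.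
  by apply: jle_trans (KF _ Kx) _; rewrite -vx.
have [N finN NL] : exists2 N, finite_set N &
    forall x, K x -> exists2 n, N n & lrel x n.
  pose r a b := a = b \/ (~ F a /\ ~ F b) \/ (K a /\ K b).
  have cr : right_cong r.
    split; first split.
    - by move=> a; left.
    - by move=> a b; rewrite /r; case=> [->|]; tauto.
    - move=> a b c; rewrite /r; case=> [->//|h] [<-|h']; first by right.
      by right; have := KF b; tauto.
    - move=> a b s [->|[[nFa nFb]|[Ka Kb]]]; first by left.
        by right; left; rewrite !FM; tauto.
      have [Fs|nFs] := pselect (F s); first by right; right; split; apply: KM.
      by right; left; rewrite !FM; tauto.
  have cover a : (~` F) a \/ exists2 c, (T `|` [set k]) c & r a c.
    have [/FTK[Ta|Ka]|] := pselect (F a); last by left.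
      by right; exists a; [left|left].
    by right; exists k; [right|right; right; split=> //; split].
  have finC : finite_set (T `|` [set k]) by rewrite finite_setU.
  have rF a b : (~` F) a -> (~` F) b -> r a b by move=> nFa nFb; right; left.
  have [U finU genU] := f_noetherian_generated nB cr finC rF cover.
  pose P := T `|` (U `&` K).
  have finP : finite_set P by rewrite finite_setU; split=> //; apply: finite_setIl.
  have PF p : P p -> F p by move=> [[]//|[_ /KF]].
  pose M := [set p * q | p in P & q in P].
  pose ML x := exists2 m, M m & lrel x m.
  (* Up to L, [M] is closed under right translation by [T]: in [p * q * s], either
     [q * s] is in [T], which leaves two factors, or it is in [K], and then the
     whole product is L-related to [q * s]. *)
  have MLM a s : K a -> K (a * s) -> ML a -> T s -> ML (a * s).
    move=> Ka Kas [_ [p Pp [q Pq <-]] apq] Ts.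
    have Fqs : F (q * s) by apply/FM; split; [apply: PF|case: Ts].
    have aspqs := lrelM s apq.
    have [Tqs|Kqs] := FTK _ Fqs.
      exists (p * (q * s)); last by rewrite mulgA.
      by exists p => //; exists (q * s) => //; left.
    exists (q * s); first by exists q => //; exists s => //; left.
    apply: lrel_trans aspqs _; rewrite -mulgA; apply: lrel_mull.
    by apply: jle_trans (proj2 Kqs) _; apply: PF.
  pose t a b := a = b \/ (~ F a /\ ~ F b) \/
    (K a /\ K b /\ (lrel a b \/ ML a /\ ML b)).
  have MLl a b : lrel a b -> ML b -> ML a.
    by move=> ab [m Mm bm]; exists m => //; apply: lrel_trans ab bm.
  have ct : right_cong t.
    split; first split.
    - by move=> a; left.
    - move=> a b; rewrite /t; case=> [->|]; first by left.
      by have := @lrel_sym a b; tauto.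
    - move=> a b c; rewrite /t; case=> [->//|h] [<-|h']; first by right.
      have := @lrel_trans a b c; have := KF b; have := MLl a b.
      by have := MLl c b; have := @lrel_sym b c; tauto.
    - move=> a b s [->|[[nFa nFb]|[Ka [Kb ab]]]]; first by left.
        by right; left; rewrite !FM; tauto.
      have [Fs|nFs] := pselect (F s); last by right; left; rewrite !FM; tauto.
      right; right; have [Kas Kbs] := (KM a s Ka Fs, KM b s Kb Fs).
      split=> //; split=> //; case: ab => [ab|[Na Nb]]; first by left; apply: lrelM.
      have [Ts|[ks sk]] := FTK _ Fs; first by right; split; apply: MLM.
      left; apply: (@lrel_trans _ s); [|apply: lrel_sym]; apply: lrel_mull.
        by apply: jle_trans sk _; apply: KF.
      by apply: jle_trans sk _; apply: KF.
  have tU u v : U u -> U v -> r u v -> t u v.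
    move=> Uu Uv [->|[?|[Ku Kv]]]; [by left|by right; left|right; right].
    do 2!split=> //; right.
    by split; [exists u|exists v]; try apply: lrel_refl;
      [exists u; [right|exists u; [right|rewrite mulxx]]
      |exists v; [right|exists v; [right|rewrite mulxx]]].
  exists ([set k] `|` M).
    by rewrite finite_setU; split=> //; apply: finite_image2.
  move=> x Kx; have Kk : K k by split; apply: jrefl.
  have [->|[[nFx _]|[_ [_ [xk|[[m Mm xm] _]]]]]] := genU _ ct tU x k
    (or_intror (or_intror (conj Kx Kk))).
  - by exists k; [left|apply: lrel_refl].
  - by case: nFx; apply: KF.
  - by exists k; [left|].
  - by exists m; [right|].
apply: sub_finite_set (finite_image2 (fun v n => v * n) finV finN).
move=> x Kx; have [v Vv [vk vx]] := VR x Kx; have [n Nn [xn nx]] := NL x Kx.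
have vn : jle v n.
  by apply: jle_trans vk (jle_trans (KF _ Kx) _); rewrite -xn; apply: jmulr.
by exists v => //; exists n => //; rewrite -nx -{1}vx !mulgA (rectangular vn) vx.
Qed.

(** The J-classes form a semilattice, which is finite; and a J-class is finite
    as soon as all the J-classes above it are. *)
Lemma f_noetherian_band_finite : f_noetherian B -> finite_set [set: B].
Proof.
move=> nB; pose J := [set p : B * B | jle p.1 p.2 /\ jle p.2 p.1].
have cJ : congruence J.
  split; first split.
  - by move=> a; split; apply: jrefl.
  - by move=> a b [/= ab ba]; split.
  - move=> a b c [/= ab ba] [/= bc cb].
    by split; [apply: jle_trans ab bc|apply: jle_trans cb ba].
  - move=> a b s [/= ab ba]; rewrite /J /=.
    split; split; apply/jmulP; split; try exact: jmull; try exact: jmulr.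
    + exact: jle_trans (jmull _ _) ab.
    + exact: jle_trans (jmull _ _) ba.
    + exact: jle_trans (jmulr _ _) ab.
    + exact: jle_trans (jmulr _ _) ba.
have [Y [f [fM fsurj fJ]]] := quotient_semigroup cJ.
have YC (y z : Y) : y * z = z * y.
  have [[a <-] [b <-]] := (fsurj y, fsurj z); rewrite -!fM; apply/fJ.
  by split; apply/jmulP; split; try exact: jmull; exact: jmulr.
have Yxx (y : Y) : y * y = y by have [a <-] := fsurj y; rewrite -fM mulxx.
have finY :=
  f_noetherian_semilattice_finite YC Yxx (f_noetherian_quotient fM fsurj nB).
have upP a b : up (f a) (f b) <-> jle a b.
  rewrite /up /= -fM fJ; split=> [[_ /= /jmulP[]]//|ab].
  by split=> /=; [apply: jmull|apply/jmulP].
pose bad := [set y : Y | ~ finite_set [set a | f a = y]].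
have [bad0|/set0P bad_ne] := eqVneq bad set0.
  have fib (y : Y) : finite_set [set a | f a = y].
    by apply: contrapT => ny; have : bad y by []; rewrite bad0.
  apply: sub_finite_set (bigcup_finite finY (fun (y : Y) _ => fib y)).
  by move=> a _; exists (f a).
have [m badm mmax] :=
  finite_has_maximal YC (sub_finite_set (@subsetT _ bad) finY) bad_ne.
have [k fk] := fsurj m.
case: badm; apply: sub_finite_set (@J_class_finite k nB _).
  by move=> a /= fa; apply/and_comm/fJ; rewrite fa fk.
apply: (@sub_finite_set _ _ (\bigcup_(y in (~` bad : set Y)) [set a | f a = y])).
  move=> a [/upP]; rewrite fk => /= ma nak; exists (f a) => // bada.
  by apply: nak; apply/upP; rewrite fk (mmax _ bada ma); apply: Yxx.
apply: bigcup_finite; first exact: sub_finite_set (@subsetT _ _) finY.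
by move=> y /= /contrapT.
Qed.

End Bands.

(** * Cryptogroups *)

Section Cryptogroups.
Variable S : semigroupType.
Implicit Types a b e f x y : S.

Lemma completely_regular_inv : completely_regular S ->
  exists inv : S -> S, forall x, x * inv x * x = x /\ x * inv x = inv x * x.
Proof.
move=> crS; suff /choice[inv invP] : forall x, exists y, x * y * x = x /\ x * y = y * x.
  by exists inv.
move=> x; have [G [_ [e _ [eG invG]]] Gx] : (\bigcup_(G in @subgroup S) G) x by rewrite crS.
have [y _ [xy yx]] := invG x Gx; exists y; rewrite xy yx; split=> //.
exact: (proj1 (eG x Gx)).
Qed.

Lemma green_H_square inv x : x * inv * x = x -> x * inv = inv * x ->
  green_H S (x * x, x).
Proof.
move=> xVx xV; have xxV : x * x * inv = x by rewrite -mulgA xV mulgA.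
have Vxx : inv * x * x = x by rewrite -xV.
split; apply/seteqP; split=> /= y.
- by case=> [->|[s _ <-]]; right; [exists x|exists (s * x)]; rewrite ?mulgA.
- case=> [->|[s _ <-]]; right; first by exists inv; rewrite ?mulgA.
  by exists (s * inv) => //; rewrite -!mulgA (mulgA inv) Vxx.
- by case=> [->|[s _ <-]]; right; [exists x|exists (x * s)]; rewrite ?mulgA.
- case=> [->|[s _ <-]]; right; first by exists inv.
  by exists (inv * s) => //; rewrite mulgA xxV.
Qed.

Lemma green_H_idem_eq e f : e * e = e -> f * f = f -> green_H S (e, f) -> e = f.
Proof.
move=> ee ff [/= Lef Ref].
have ef : e * f = e.
  have : left_ideal1 f e by rewrite -Lef; left.
  by case=> [->//|[s _ <-]]; rewrite -mulgA ff.
have : right_ideal1 e f by rewrite Ref; left.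
by case=> [//|[s _ fes]]; rewrite -ef -fes mulgA ee.
Qed.

End Cryptogroups.

Theorem theorem5p7 (S : semigroupType) (hS : cryptogroup S)
  (hf : f_noetherian S) : fg_semigroup S.
Proof.
have [crS cH] := hS; have [inv invP] := completely_regular_inv crS.
have mulVK x := proj1 (invP x); have inv_comm x := proj2 (invP x).
have [B [h [hM hsurj hH]]] := quotient_semigroup cH.
have Bxx (b : B) : b * b = b.
  have [a <-] := hsurj b; rewrite -hM; apply/hH.
  exact: green_H_square (mulVK a) (inv_comm a).
have finB := f_noetherian_band_finite Bxx (f_noetherian_quotient hM hsurj hf).
pose E := [set e : S | e * e = e].
have finE : finite_set E.
  (* An H-class contains at most one idempotent. *)
  have /choice[g gP] : forall b, exists a,
      (exists2 e, E e & h e = b) -> E a /\ h a = b.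
    move=> b; have [[e Ee he]|nb] := pselect (exists2 e, E e & h e = b).
      by exists e.
    have [a _] := hsurj b; by exists a.
  apply: sub_finite_set (finite_image g finB) => e Ee; exists (h e) => //.
  have [|Eg hg] := gP (h e); first by exists e.
  by apply: green_H_idem_eq => //; apply/hH.
have /choice[A AP] : forall e, exists A, E e -> finite_set A /\
    forall x, e * x = x -> x * e = x -> jle e x -> smallest (@subsemigroup S) A x.
  move=> e; have [Ee|nEe] := pselect (E e); last by exists set0.
  by have [A ? ?] := local_group_fg mulVK inv_comm hf finE Ee; exists A.
exists (\bigcup_(e in E) A e).
  by apply: bigcup_finite => // e /AP[].
apply/seteqP; split=> // x _.
have Ex : E (x * inv x) by rewrite /E /= mulgA mulVK.
have xE : x * (x * inv x) = x by rewrite inv_comm mulgA mulVK.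
have le_xx : jle (x * inv x) x by apply: jle_mull.
have [_ genx] := AP _ Ex; move=> M [MM AM].
apply: (genx _ (mulVK x) xE le_xx) => //; split=> // y Ay.
by apply: AM; exists (x * inv x).
Qed.
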